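(* Let $\mathfrak{X}=(X,\{R_0,R_1,R_2,R_3,R_4\})$ be a skew-symmetric association scheme with $4$ classes such that $R_1=R_4^{T}$ and $R_2=R_3^{T}$, and let $n=|X|$. Let the symmetrization $\mathfrak{X}^{\mathrm{sym}}=(X,\{R_0,R_1\cup R_4,R_2\cup R_3\})$ have eigenmatrix $$\widetilde P=\begin{pmatrix}1&k_1&k_2\\1&r&t\\1&s&u\end{pmatrix}$$ with multiplicities $1,m_1,m_2$ of its rows, where $r\ge 0>s$ (so $t=-r-1$, $u=-s-1$). Then, for a suitable ordering $E_0,E_1,\dots,E_4$ of the primitive idempotents of $\mathfrak{X}$ (with $E_0=\frac1n J$), the eigenmatrix of $\mathfrak{X}$ (columns indexed by $A_0,A_1,A_2,A_3,A_4$) is $$P=\begin{pmatrix}1&k_1/2&k_2/2&k_2/2&k_1/2\\1&\rho&\tau&\overline{\tau}&\overline{\rho}\\1&\sigma&\omega&\overline{\omega}&\overline{\sigma}\\1&\overline{\sigma}&\overline{\omega}&\omega&\sigma\\1&\overline{\rho}&\overline{\tau}&\tau&\rho\end{pmatrix},$$ where $\rho,\omega,\tau,\sigma$ take values in one of the following three cases (with $\sqrt{-x}=i\sqrt{x}$ for $x\ge 0$): (i) $\sigma=\frac{s}{2}$, $\tau=\frac{t}{2}$, $\rho=\frac12\left(r+\sqrt{-\frac{nk_1}{m_1}}\right)$, $\omega=\frac12\left(u+\sqrt{-\frac{nk_2}{m_2}}\right)$; (ii) $\rho=\frac{r}{2}$, $\omega=\frac{u}{2}$, $\sigma=\frac12\left(s+\sqrt{-\frac{nk_1}{m_2}}\right)$,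 $\tau=\frac12\left(t+\sqrt{-\frac{nk_2}{m_1}}\right)$; (iii) $\rho=\frac12(r+\sqrt{-y})$, $\tau=\frac12(t+\sqrt{-z})$, $\sigma=\frac12(s+\sqrt{-b})$, $\omega=\frac12(u-\sqrt{-c})$, where $b,c,y,z$ are all positive real numbers satisfying $$\frac{y}{k_1}+\frac{z}{k_2}=\frac{n}{m_1},\qquad \frac{b}{k_1}+\frac{c}{k_2}=\frac{n}{m_2},\qquad \frac{\sqrt{by}}{k_1}-\frac{\sqrt{cz}}{k_2}=0.$$
   Context: An association scheme $(X,\{R_0,\dots,R_d\})$ on a finite set $X$: $R_0$ is the diagonal relation, the $R_i$ partition $X\times X$, each inverse $R_i^T=\{(y,x):(x,y)\in R_i\}$ is some $R_{i'}$, and for all $i,j,k$ the number $|\{z:(x,z)\in R_i,(z,y)\in R_j\}|$ is a constant $p^k_{ij}$ for all $(x,y)\in R_k$. It is skew-symmetric if $R_0$ is the only relation with $R_i^T=R_i$. (Association schemes with at most 4 classes are commutative.) For a commutative scheme with adjacency matrices $A_0,\dots,A_d$ and primitive idempotents $E_0,\dots,E_d$ of its Bose–Mesner algebra, the eigenmatrix $P=(P_{ij})$ is defined by $A_j=\sum_i P_{ij}E_i$; row $i$ has multiplicity $m_i=\operatorname{rank}E_i$, and $P_{0j}=k_j$ is the valency of $R_j$. The symmetrization of a skew-symmetric 4-class scheme with $R_4=R_1^T$, $R_3=R_2^T$ is the 2-class symmetric scheme $(X,\{R_0,R_1\cup R_4,R_2\cup R_3\})$; $k_1,k_2$ are its valencies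 and $r,s$ (resp. $t,u$) are the nontrivial eigenvalues of the adjacency matrix of $R_1\cup R_4$ (resp. $R_2\cup R_3$).
   Formalization: Case (iii) is proved up to interchanging the names R_2 and R_3 (tau, omega replaced by their conjugates); for a fixed labelling it is false, e.g. for X = Z/5 with R_1={y-x=1}, R_2={y-x=3}. *)

(* Defs.v *)
From HB Require Import structures.
From mathcomp Require Import all_boot all_order all_algebra.

Set Implicit Arguments.
Unset Strict Implicit.
Unset Printing Implicit Defensive.

Import Order.TTheory GRing.Theory Num.Theory.
Local Open Scope ring_scope.

Definition transpose_rel (X : finType) (S : {set X * X}) : {set X * X} :=
  [set p | (p.2, p.1) \in S].

(* [partition] requires the blocks to be nonempty, so there are exactly d + 1
   nonempty relations (and X is nonempty). *)
Definition assoc_scheme (X : finType) (d : nat) (R : 'I_d.+1 -> {set X * X}) :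
    Prop :=
  [/\ R ord0 = [set p | p.1 == p.2],
      injective R /\ partition [set R i | i : 'I_d.+1] [set: X * X],
      forall i, exists i', transpose_rel (R i) = R i' &
      forall i j k, exists p : nat, forall x y, (x, y) \in R k ->
        #|[set z | ((x, z) \in R i) && ((z, y) \in R j)]| = p].

Definition skew_symmetric (X : finType) (d : nat)
    (R : 'I_d.+1 -> {set X * X}) : Prop :=
  forall i, transpose_rel (R i) = R i -> i = ord0.

Definition symmetrization (X : finType) (R : 'I_5 -> {set X * X}) :
    'I_3 -> {set X * X} :=
  tnth [tuple R 0; R 1 :|: R 4; R 2 :|: R 3].

(* Square matrices indexed by X are matrices of size #|X|, the index i
   standing for the point enum_val i. *)
Definition adjmx (C : numClosedFieldType) (X : finType) (S : {set X * X}) :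
    'M[C]_#|X| :=
  \matrix_(i, j) ((enum_val i, enum_val j) \in S)%:R.

Definition in_bose_mesner (C : numClosedFieldType) (X : finType) (d : nat)
    (R : 'I_d.+1 -> {set X * X}) (M : 'M[C]_#|X|) : Prop :=
  exists c : 'I_d.+1 -> C, M = \sum_i c i *: adjmx C (R i).

Definition bm_idempotent (C : numClosedFieldType) (X : finType) (d : nat)
    (R : 'I_d.+1 -> {set X * X}) (M : 'M[C]_#|X|) : Prop :=
  in_bose_mesner R M /\ M *m M = M.

Definition primitive_idempotent (C : numClosedFieldType) (X : finType)
    (d : nat) (R : 'I_d.+1 -> {set X * X}) (M : 'M[C]_#|X|) : Prop :=
  [/\ bm_idempotent R M, M <> 0 &
      forall F G : 'M[C]_#|X|, bm_idempotent R F -> bm_idempotent R G ->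
        F *m G = 0 -> G *m F = 0 -> M = F + G -> F = 0 \/ G = 0].

(* E lists all the primitive idempotents, each exactly once, starting with
   J / |X|. *)
Definition idempotent_ordering (C : numClosedFieldType) (X : finType)
    (d : nat) (R : 'I_d.+1 -> {set X * X}) (E : 'I_d.+1 -> 'M[C]_#|X|) :
    Prop :=
  [/\ injective E,
      forall M, primitive_idempotent R M <-> exists i, M = E i &
      E ord0 = const_mx (#|X|%:R^-1)].

Definition is_eigenmatrix (C : numClosedFieldType) (X : finType) (d : nat)
    (R : 'I_d.+1 -> {set X * X}) (E : 'I_d.+1 -> 'M[C]_#|X|)
    (P : 'M[C]_d.+1) : Prop :=
  forall j, adjmx C (R j) = \sum_i P i j *: E i.

Definition mx_of_rows (C : numClosedFieldType) (n : nat) (rows : seq (seq C)) :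
    'M[C]_n :=
  \matrix_(i, j) nth 0 (nth [::] rows i) j.

Definition sym_eigenmatrix (C : numClosedFieldType) (k1 k2 r s t u : C) :
    'M[C]_3 :=
  mx_of_rows 3 [:: [:: 1; k1; k2];
                   [:: 1; r; t];
                   [:: 1; s; u]].

Definition skew_eigenmatrix (C : numClosedFieldType)
    (k1 k2 rho tau sigma omega : C) : 'M[C]_5 :=
  mx_of_rows 5 [:: [:: 1; k1 / 2; k2 / 2; k2 / 2; k1 / 2];
                   [:: 1; rho; tau; tau^*; rho^*];
                   [:: 1; sigma; omega; omega^*; sigma^*];
                   [:: 1; sigma^*; omega^*; omega; sigma];
                   [:: 1; rho^*; tau^*; tau; rho]].

(* The value of sqrt(-x) for x >= 0. *)
Definition sqrtN (C : numClosedFieldType) (x : C) : C := 'i * sqrtC x.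

Definition case_i (C : numClosedFieldType) (n k1 k2 m1 m2 r s t u : C)
    (rho tau sigma omega : C) : Prop :=
  [/\ sigma = s / 2,
      tau = t / 2,
      rho = (r + sqrtN (n * k1 / m1)) / 2 &
      omega = (u + sqrtN (n * k2 / m2)) / 2].

Definition case_ii (C : numClosedFieldType) (n k1 k2 m1 m2 r s t u : C)
    (rho tau sigma omega : C) : Prop :=
  [/\ rho = r / 2,
      omega = u / 2,
      sigma = (s + sqrtN (n * k1 / m2)) / 2 &
      tau = (t + sqrtN (n * k2 / m1)) / 2].

(* In a numClosedFieldType, 0 < x forces x to be real. *)
Definition case_iii (C : numClosedFieldType) (n k1 k2 m1 m2 r s t u : C)
    (rho tau sigma omega : C) : Prop :=
  exists b c y z : C,
    [/\ [/\ 0 < b, 0 < c, 0 < y & 0 < z],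
        [/\ rho = (r + sqrtN y) / 2,
            tau = (t + sqrtN z) / 2,
            sigma = (s + sqrtN b) / 2 &
            omega = (u - sqrtN c) / 2] &
        [/\ y / k1 + z / k2 = n / m1,
            b / k1 + c / k2 = n / m2 &
            sqrtC (b * y) / k1 - sqrtC (c * z) / k2 = 0]].

(* Main.v *)
(* The idempotents F_0, F_1, F_2 of the symmetrization span the symmetric
   elements of the Bose-Mesner algebra A of the scheme.  For M in A and i <> j,
   the matrix F_i M F_j + (F_i M F_j)^T is symmetric with zero diagonal blocks,
   hence zero; so each F_i is central.  The skew elements of A are spanned by
   S_1 = A_1 - A_4 and S_2 = A_2 - A_3.  They cannot both lie in one block F_i A:
   being trace-orthogonal they would anticommute, S_1 S_2 would be a skew element
   anticommuting with both, hence 0, while S_1^2 is a nonzero multiple of F_i.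
   So the blocks of F_1 and F_2 each contain a real skew D_i with D_i^2 = - F_i,
   and the primitive idempotents are F_0 and (F_i +- sqrt(-1) D_i) / 2.  Writing
   S_1 = a_1 D_1 + a_2 D_2 and S_2 = b_1 D_1 + b_2 D_2, the traces of S_i S_j^T say
   that the suitably scaled 2 x 2 coefficient matrix is orthogonal; orthogonality
   of its columns and the signs of the D_i give the three cases. *)

Require Import Defs.
From HB Require Import structures.
From mathcomp Require Import all_boot all_order all_algebra ring.

Set Implicit Arguments.
Unset Strict Implicit.
Unset Printing Implicit Defensive.

Import Order.TTheory GRing.Theory Num.Theory.
Local Open Scope ring_scope.

(** * Idempotent matrices and a choice of sign *)

(** In a full-rank factorization [M = U V], idempotence forces [V U = 1] of size the rank, and the
    trace is cyclic. *)
Lemma mxtrace_idem (K : fieldType) (n : nat) (M : 'M[K]_n) :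
  M *m M = M -> \tr M = (\rank M)%:R.
Proof.
move=> MM; rewrite -{1}(mulmx_base M) mxtrace_mulC -mxtrace1; congr (\tr _).
apply: (row_full_inj (col_base_full M)); apply: (row_free_inj (row_base_free M)).
rewrite mulmx1 -[LHS]mulmxA -(mulmxA (row_base M)) mulmx_base.
by rewrite (mulmxA (col_base M)) mulmx_base MM.
Qed.

(** [P + Q] is idempotent, being the complement of [S], so [P] and [Q] anticommute; then [P Q P]
    equals both [P Q] and its opposite. *)
Lemma idem_sum1_orth (K : numFieldType) (n : nat)
    (P Q S : 'M[K]_n) :
  P *m P = P -> Q *m Q = Q -> S *m S = S -> P + Q + S = 1%:M -> P *m Q = 0.
Proof.
move=> PP QQ SS sum1.
have eS : S = 1%:M - (P + Q) by rewrite -sum1 addrC addKr.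
have anti : P *m Q = - (Q *m P).
  apply/eqP; rewrite -addr_eq0 -(inj_eq (addrI (P + Q))) addr0.
  have e : (P + Q) *m (P + Q) = P + Q.
    have -> : P + Q = 1%:M - S by rewrite eS subKr.
    by rewrite mulmxBl mul1mx mulmxBr mulmx1 SS subrr subr0.
  rewrite -[X in _ == X]e mulmxDl !mulmxDr PP QQ [Q *m P + Q]addrC.
  by rewrite [X in _ == X]addrACA.
have e1 : P *m Q *m P = - (P *m Q).
  by rewrite -mulmxA -[Q *m P]opprK -anti mulmxN mulmxA PP.
have e2 : P *m Q *m P = P *m Q.
  by rewrite anti mulNmx -mulmxA PP.
have /eqP : P *m Q *+ 2 = 0 by rewrite mulr2n -{1}e2 e1 addNr.
by rewrite -scaler_nat scaler_eq0 pnatr_eq0 => /eqP.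
Qed.

(** Serves to orient the imaginary unit of a block: the first coordinate becomes nonnegative, or the
    second one when the first vanishes. *)
Lemma real_ex_sign (C : numFieldType) (a b : C) : a \is Num.real -> b \is Num.real ->
  exists2 e : C, e = 1 \/ e = -1 & 0 <= e * a /\ (e * a = 0 -> 0 <= e * b).
Proof.
move=> ra rb; have [a_gt0|a_lt0|<-] := real_ltgtP (real0 _) ra.
- by exists 1; [left|rewrite mul1r ltW //; split=> // a0; rewrite a0 ltxx in a_gt0].
- exists (-1); [by right|rewrite mulN1r oppr_ge0 ltW //; split=> // /eqP].
  by rewrite oppr_eq0 lt_eqF.
have [b_ge0|b_lt0] := real_leP (real0 _) rb.
  by exists 1; [left|rewrite mulr0 mul1r lexx].
by exists (-1); [right|rewrite mulr0 mulN1r oppr_ge0 lexx ltW].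
Qed.

(** * Real matrices and their positive definite trace form *)

Section RealMatrices.

Variables (C : numClosedFieldType) (n : nat).
Implicit Types M N : 'M[C]_n.

Lemma mxtrace_mul_tr M N : \tr (M *m N^T) = \sum_i \sum_j M i j * N i j.
Proof. by apply: eq_bigr => i _; rewrite mxE; apply: eq_bigr => j _; rewrite mxE. Qed.

Lemma mxtrace_real M : M \is a mxOver Num.real -> \tr M \is Num.real.
Proof. by move=> /mxOverP rM; apply: rpred_sum. Qed.

Lemma mxtrace_mul_tr_ge0 M : M \is a mxOver Num.real -> 0 <= \tr (M *m M^T).
Proof.
move=> /mxOverP rM; rewrite mxtrace_mul_tr.
by do 2!apply: sumr_ge0 => ? _; rewrite -expr2 real_exprn_even_ge0.
Qed.

Lemma mxtrace_mul_tr_eq0 M :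
  M \is a mxOver Num.real -> \tr (M *m M^T) = 0 -> M = 0.
Proof.
move=> /mxOverP rM; rewrite mxtrace_mul_tr => /eqP.
have sq_ge0 i j : 0 <= M i j * M i j by rewrite -expr2 real_exprn_even_ge0.
rewrite psumr_eq0 => [/allP /= s0|i _]; last exact: sumr_ge0.
apply/matrixP => i j; rewrite mxE; have := s0 i (mem_index_enum _).
rewrite psumr_eq0 // => /allP /(_ j (mem_index_enum _)) /=.
by rewrite mulf_eq0 orbb => /eqP.
Qed.

Lemma mxOver_realD M N : M \is a mxOver Num.real -> N \is a mxOver Num.real ->
  M + N \is a mxOver Num.real.
Proof. by move=> /mxOverP rM /mxOverP rN; apply/mxOverP => i j; rewrite mxE realD. Qed.

Lemma mxOver_realN M : M \is a mxOver Num.real -> - M \is a mxOver Num.real.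
Proof. by move=> /mxOverP rM; apply/mxOverP => i j; rewrite mxE realN. Qed.

Lemma mxOver_realB M N : M \is a mxOver Num.real -> N \is a mxOver Num.real ->
  M - N \is a mxOver Num.real.
Proof. by move=> rM rN; apply/mxOver_realD/mxOver_realN. Qed.

Lemma mxOver_real_tr M : (M^T \is a mxOver Num.real) = (M \is a mxOver Num.real).
Proof. by apply/mxOverP/mxOverP => rM i j; have := rM j i; rewrite mxE. Qed.

End RealMatrices.

(** * Skew elements of an algebra whose symmetric part is spanned by three idempotents *)

Section SkewAlgebra.

(** [A] abstracts the Bose-Mesner algebra, [F] the idempotents of the symmetrization, and [S1], [S2]
    the differences [A_1 - A_4], [A_2 - A_3]. *)
Variables (C : numClosedFieldType) (n : nat) (A : 'M[C]_n -> Prop).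
Variables (F : 'I_3 -> 'M[C]_n) (S1 S2 : 'M[C]_n).

Hypothesis addA : forall M N, A M -> A N -> A (M + N).
Hypothesis scaleA : forall c M, A M -> A (c *: M).
Hypothesis mulA : forall M N, A M -> A N -> A (M *m N).
Hypothesis trA : forall M, A M -> A M^T.
Hypothesis symA : forall M, A M -> M^T = M ->
  exists c : 'I_3 -> C, M = \sum_i c i *: F i.
Hypothesis skewA : forall M, A M -> M^T = - M ->
  exists x y, M = x *: S1 + y *: S2.

Hypothesis FA : forall i, A (F i).
Hypothesis Fsym : forall i, (F i)^T = F i.
Hypothesis Freal : forall i, F i \is a mxOver Num.real.
Hypothesis Forth : forall i j, F i *m F j = (i == j)%:R *: F i.
Hypothesis Fsum : \sum_i F i = 1%:M.
Hypothesis F_neq0 : forall i, F i != 0.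

Hypothesis S1A : A S1.
Hypothesis S2A : A S2.
Hypothesis S1skew : S1^T = - S1.
Hypothesis S2skew : S2^T = - S2.
Hypothesis S1real : S1 \is a mxOver Num.real.
Hypothesis S2real : S2 \is a mxOver Num.real.
Hypothesis S1_neq0 : S1 != 0.
Hypothesis S2_neq0 : S2 != 0.
Hypothesis S12_orth : \tr (S1 *m S2) = 0.
Hypothesis F0S : forall M, A M -> M^T = - M -> F 0 *m M *m F 0 = 0.

Lemma oppA M : A M -> A (- M).
Proof. by move=> AM; rewrite -scaleN1r; apply: scaleA. Qed.

Lemma F_idem i : F i *m F i = F i.
Proof. by rewrite Forth eqxx scale1r. Qed.

Lemma F_orth i j : i != j -> F i *m F j = 0.
Proof. by rewrite Forth => /negPf ->; rewrite scale0r. Qed.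

Lemma mulF_sum i (c : 'I_3 -> C) : F i *m (\sum_j c j *: F j) = c i *: F i.
Proof.
rewrite mulmx_sumr (bigD1 i) //= big1 => [|j ji].
  by rewrite addr0 -scalemxAr F_idem.
by rewrite -scalemxAr F_orth 1?eq_sym // scaler0.
Qed.

(* A symmetric element of [A] is a combination of the [F k], so its
   off-diagonal blocks vanish; apply this to [F i M F j] plus its transpose. *)
Lemma offdiag_block0 M i j : A M -> i != j -> F i *m M *m F j = 0.
Proof.
move=> AM ij; pose N := F i *m M *m F j.
have AN : A N by do ?apply: mulA.
have [|c defN] := symA (addA AN (trA AN)).
  by rewrite linearD /= trmxK addrC.
have := congr1 (fun Z => F i *m Z *m F j) defN.
rewrite mulF_sum -scalemxAl F_orth // scaler0 => <-.
rewrite /N !trmx_mul !Fsym mulmxDr mulmxDl !mulmxA F_idem.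
rewrite -[F i *m M *m F j *m F j]mulmxA F_idem.
by rewrite [F i *m F j]F_orth // !mul0mx addr0.
Qed.

Lemma mulF_block M i : A M -> F i *m M = F i *m M *m F i.
Proof.
move=> AM; rewrite -[LHS]mulmx1 -Fsum mulmx_sumr (bigD1 i) //= big1 ?addr0 //.
by move=> j ji; rewrite offdiag_block0 // eq_sym.
Qed.

Lemma mulmxF_block M i : A M -> M *m F i = F i *m M *m F i.
Proof.
move=> AM; rewrite -[LHS]mul1mx -Fsum mulmx_suml (bigD1 i) //= big1 ?mulmxA ?addr0 //.
by move=> j ji; rewrite mulmxA offdiag_block0.
Qed.

(** Both products equal the diagonal block of [M]; commutativity of [A] is not assumed. *)
Lemma F_central M i : A M -> F i *m M = M *m F i.
Proof. by move=> AM; rewrite mulF_block // -mulmxF_block. Qed.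

Lemma F0_skew M : A M -> M^T = - M -> F 0 *m M = 0.
Proof. by move=> AM tM; rewrite mulF_block // F0S. Qed.

Lemma sym_block M i : A M -> M^T = M -> F i *m M = M -> exists c, M = c *: F i.
Proof.
move=> AM /(symA AM)[c defM] FM; exists (c i).
by rewrite -FM defM mulF_sum.
Qed.

Lemma mxtrace_F_neq0 i : \tr (F i) != 0.
Proof. by rewrite mxtrace_idem ?F_idem // pnatr_eq0 mxrank_eq0. Qed.

Lemma mxtrace_F_gt0 i : 0 < \tr (F i).
Proof. by rewrite mxtrace_idem ?F_idem // ltr0n lt0n mxrank_eq0. Qed.

(** The square is symmetric and lies in the block, hence is a multiple of [F i]; the trace of
    [M *m M^T] decides the sign. *)
Lemma skew_block_sqr M i : A M -> M \is a mxOver Num.real -> M^T = - M ->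
    F i *m M = M -> M != 0 ->
  exists2 c, 0 < c & M *m M = - c *: F i.
Proof.
move=> AM rM tM FM M_neq0.
have [||c defMM] := @sym_block (M *m M) i (mulA AM AM).
- by rewrite trmx_mul tM mulNmx mulmxN opprK.
- by rewrite mulmxA FM.
exists (- c); last by rewrite opprK.
have eqt : \tr (M *m M^T) = - c * \tr (F i).
  by rewrite tM mulmxN defMM linearN /= linearZ mulNr.
rewrite -(pmulr_lgt0 _ (mxtrace_F_gt0 i)) -eqt lt_def mxtrace_mul_tr_ge0 //.
by rewrite andbT; apply: contra_neq M_neq0; apply: mxtrace_mul_tr_eq0.
Qed.

(* Orthogonal skew elements of a single block anticommute, so their product
   is again skew, hence a combination of [S1] and [S2]; anticommutators with
   [S1] and [S2] then kill it, although [S1] is invertible in the block. *)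
Lemma skew_not_in_block i : F i *m S1 = S1 -> F i *m S2 = S2 -> False.
Proof.
move=> FS1 FS2.
have [||c defN] := @sym_block (S1 *m S2 + S2 *m S1) i (addA (mulA S1A S2A) (mulA S2A S1A)).
- by rewrite linearD /= !trmx_mul S1skew S2skew !mulNmx !mulmxN !opprK addrC.
- by rewrite mulmxDr !mulmxA FS1 FS2.
have c0 : c = 0.
  have := congr1 mxtrace defN; rewrite linearD linearZ /= [\tr (S2 *m _)]mxtrace_mulC.
  rewrite S12_orth addr0 => /esym/eqP; rewrite mulf_eq0 (negPf (mxtrace_F_neq0 i)).
  by rewrite orbF => /eqP.
have anti : S2 *m S1 = - (S1 *m S2).
  by apply/eqP; rewrite -addr_eq0 addrC defN c0 scale0r.
have [|x [y defT]] := @skewA (S1 *m S2) (mulA S1A S2A).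
  by rewrite trmx_mul S1skew S2skew mulNmx mulmxN opprK anti.
(* In the anticommutator of [S] with [x *: S1 + y *: S2] the mixed term cancels, leaving twice a
   multiple of [S *m S], which is nonzero. *)
have sq0 (S : 'M[C]_n) z : A S -> S \is a mxOver Num.real -> S^T = - S ->
    F i *m S = S -> S != 0 -> z *: (S *m S) *+ 2 = 0 -> z = 0.
  move=> SA rS tS FS S_neq0; have [d d_gt0 ->] := skew_block_sqr SA rS tS FS S_neq0.
  move/eqP; rewrite -scaler_nat !scaler_eq0 pnatr_eq0 /= (negPf (F_neq0 i)) orbF.
  by rewrite oppr_eq0 (gt_eqF d_gt0) orbF => /eqP.
have x0 : x = 0.
  apply: (sq0 S1) => //.
  have : S1 *m (S1 *m S2) + (S1 *m S2) *m S1 = 0.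
    by rewrite -[S1 *m S2 *m S1]mulmxA anti mulmxN subrr.
  rewrite defT mulmxDr mulmxDl -!scalemxAr -!scalemxAl addrACA.
  by rewrite -[X in _ + X]scalerDr anti subrr scaler0 addr0 mulr2n.
have y0 : y = 0.
  apply: (sq0 S2) => //.
  have : S2 *m (S1 *m S2) + (S1 *m S2) *m S2 = 0.
    by rewrite [S2 *m (_ *m _)]mulmxA anti mulNmx addNr.
  rewrite defT mulmxDr mulmxDl -!scalemxAr -!scalemxAl addrACA.
  by rewrite -[X in X + _]scalerDr anti addNr scaler0 add0r mulr2n.
have [d d_gt0 defS] := skew_block_sqr S1A S1real S1skew FS1 S1_neq0.
have := congr1 (mulmx S1) defT; rewrite x0 y0 !scale0r addr0 mulmx0 mulmxA defS.
rewrite -scalemxAl FS2 => /eqP; rewrite scaler_eq0 oppr_eq0 (gt_eqF d_gt0).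
by rewrite (negPf S2_neq0).
Qed.

Lemma skew_split M : A M -> M^T = - M -> M = F 1 *m M + F 2 *m M.
Proof.
move=> AM tM; rewrite -[LHS]mul1mx -Fsum mulmx_suml 3!big_ord_recl big_ord0 addr0.
rewrite [F ord0 *m M]F0_skew // add0r.
by congr (F _ *m M + F _ *m M); apply: val_inj.
Qed.

(** [D] is an imaginary unit of the block whose identity is [F i]. *)
Definition block_unit i D :=
  [/\ A D, D \is a mxOver Num.real, D^T = - D, F i *m D = D & D *m D = - F i].

Lemma block_skew S i : A S -> S^T = - S -> (F i *m S)^T = - (F i *m S).
Proof. by move=> SA tS; rewrite trmx_mul Fsym tS mulNmx F_central. Qed.

Lemma ex_block_unit S i : A S -> S \is a mxOver Num.real -> S^T = - S ->
  F i *m S != 0 -> exists D, block_unit i D.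
Proof.
move=> SA rS tS FS_neq0; set M := F i *m S in FS_neq0.
have AM : A M by exact: mulA.
have rM : M \is a mxOver Num.real by apply: mxOverM.
have tM : M^T = - M by exact: block_skew.
have FM : F i *m M = M by rewrite mulmxA F_idem.
have [c c_gt0 defMM] := skew_block_sqr AM rM tM FM FS_neq0.
exists ((sqrtC c)^-1 *: M); split.
- exact: scaleA.
- by apply: mxOverZ => //; rewrite realV sqrtC_real // ltW.
- by rewrite linearZ /= tM scalerN.
- by rewrite -scalemxAr FM.
- rewrite -scalemxAr -scalemxAl scalerA -invfM -expr2 sqrtCK defMM scalerA.
  by rewrite mulrN mulVf ?gt_eqF // scaleN1r.
Qed.

(** If [F i] killed both [S1] and [S2], both would lie in the other block, which [skew_not_in_block]
    excludes. *)
Lemma ex_block_units :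
  exists D1 D2, block_unit 1 D1 /\ block_unit 2 D2.
Proof.
have ex i j : F i *m S1 + F j *m S1 = S1 -> F i *m S2 + F j *m S2 = S2 ->
    exists D, block_unit i D.
  have [-> e1|/(ex_block_unit S1A S1real S1skew) //] := eqVneq (F i *m S1) 0.
  have [-> e2|/(ex_block_unit S2A S2real S2skew) //] := eqVneq (F i *m S2) 0.
  by move: e1 e2; rewrite !add0r => /skew_not_in_block/[apply].
have s1 := esym (skew_split S1A S1skew); have s2 := esym (skew_split S2A S2skew).
have [D1 u1] := ex 1 2 s1 s2.
have [D2 u2] := ex 2 1 (etrans (addrC _ _) s1) (etrans (addrC _ _) s2).
by exists D1, D2.
Qed.

Lemma block_units_orth i j D1 D2 : i != j ->
  block_unit i D1 -> block_unit j D2 -> D1 *m D2 = 0.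
Proof.
move=> ij [A1 _ _ FD1 _] [_ _ _ FD2 _].
by rewrite -FD2 mulmxA -F_central // -FD1 mulmxA F_orth 1?eq_sym // !mul0mx.
Qed.

Lemma block_unit_neq0 i D : block_unit i D -> D != 0.
Proof.
move=> [_ _ _ _ DD]; apply: contra_neq (F_neq0 i) => D0.
by apply/eqP; rewrite -oppr_eq0 -DD D0 mul0mx.
Qed.

Lemma mxtrace_block_unit_mul_tr i D : block_unit i D -> \tr (D *m D^T) = \tr (F i).
Proof. by case=> _ _ -> _ DD; rewrite mulmxN DD opprK. Qed.

(** Turns norms and inner products of skew elements into quadratic relations between their
    coordinates. *)
Lemma mxtrace_block_units_mul_tr i j D1 D2 a b c d : i != j ->
    block_unit i D1 -> block_unit j D2 ->
  \tr ((a *: D1 + b *: D2) *m (c *: D1 + d *: D2)^T) =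
    a * c * \tr (F i) + b * d * \tr (F j).
Proof.
move=> ij u1 u2; have [_ _ t1 _ _] := u1; have [_ _ t2 _ _] := u2.
have h12 : D1 *m D2^T = 0 by rewrite t2 mulmxN (block_units_orth ij u1 u2) oppr0.
have h21 : D2 *m D1^T = 0.
  by rewrite t1 mulmxN (block_units_orth _ u2 u1) 1?eq_sym // oppr0.
rewrite linearD !linearZ /= mulmxDr !mulmxDl -!scalemxAl -!scalemxAr.
rewrite h12 h21 !scaler0 addr0 add0r !scalerA linearD !linearZ /=.
by rewrite (mxtrace_block_unit_mul_tr u1) (mxtrace_block_unit_mul_tr u2).
Qed.

(** [D1] and [D2] are independent and lie in the span of [S1] and [S2], so the base change is
    inverted by Cramer's rule, with determinant [d]. *)
Lemma skew_span_units D1 D2 : block_unit 1 D1 -> block_unit 2 D2 ->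
  forall M, A M -> M \is a mxOver Num.real -> M^T = - M ->
  exists a b, [/\ a \is Num.real, b \is Num.real & M = a *: D1 + b *: D2].
Proof.
move=> u1 u2 M AM rM tM.
have [A1 r1 t1 F1 _] := u1; have [A2 r2 t2 F2 _] := u2.
have [g [h def1]] := skewA A1 t1; have [g' [h' def2]] := skewA A2 t2.
have F12 : F 1 *m D2 = 0 by rewrite -F2 mulmxA F_orth // mul0mx.
have F21 : F 2 *m D1 = 0 by rewrite -F1 mulmxA F_orth // mul0mx.
pose d := g * h' - g' * h.
have indep x y : x *: D1 + y *: D2 = 0 -> x = 0 /\ y = 0.
  move=> e; have := congr1 (mulmx (F 1)) e; have := congr1 (mulmx (F 2)) e.
  rewrite !mulmxDr -!scalemxAr F1 F2 F12 F21 !scaler0 !mulmx0 add0r addr0.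
  move=> /eqP; rewrite scaler_eq0 (negPf (block_unit_neq0 u2)) orbF => /eqP ->.
  by move=> /eqP; rewrite scaler_eq0 (negPf (block_unit_neq0 u1)) orbF => /eqP ->.
have e1 : h' *: D1 - h *: D2 = d *: S1.
  rewrite {1}def1 {1}def2 !scalerDr !scalerA opprD addrACA -!scalerBl.
  by rewrite [h' * h]mulrC subrr scale0r addr0 /d; congr (_ *: _); ring.
have e2 : (- g') *: D1 + g *: D2 = d *: S2.
  rewrite {1}def1 {1}def2 !scalerDr !scalerA addrACA -!scalerDl.
  have -> : - g' * g + g * g' = 0 by ring.
  by rewrite scale0r add0r /d; congr (_ *: _); ring.
(* If [d = 0], then [e1] and [e2] become relations between the independent [D1] and [D2]; all
   coefficients vanish, and so does [D1]. *)
have d_neq0 : d != 0.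
  apply/eqP => d0; move: e1 e2; rewrite d0 !scale0r -scaleNr.
  move=> /indep[h'0 /eqP]; rewrite oppr_eq0 => /eqP h0 /indep[_ g0].
  by have := block_unit_neq0 u1; rewrite def1 g0 h0 !scale0r addr0 eqxx.
have [x [y defM]] := skewA AM tM.
pose a := d^-1 * (x * h' - y * g'); pose b := d^-1 * (y * g - x * h).
have defMab : M = a *: D1 + b *: D2.
  apply: (scalerI d_neq0); rewrite scalerDr !scalerA !mulrA divff // !mul1r.
  rewrite defM scalerDr !scalerA ![d * _]mulrC -!scalerA -e1 -e2.
  rewrite !scalerBr !scalerDr !scalerA addrACA -scalerDl -scaleNr -scalerDl.
  by congr (_ *: _ + _ *: _); ring.
(* A coordinate is recovered from traces of real matrices, hence is real. *)
have ab_real i D c : block_unit i D -> \tr (M *m D^T) = c * \tr (F i) -> c \is Num.real.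
  case=> _ rD _ _ _ e; have -> : c = \tr (M *m D^T) / \tr (F i).
    by rewrite e mulfK ?mxtrace_F_neq0.
  apply: realM; last by rewrite realV gtr0_real // mxtrace_F_gt0.
  by apply/mxtrace_real/mxOverM; rewrite ?mxOver_real_tr.
exists a, b; split=> //.
- apply: (ab_real 1 D1) => //.
  have := @mxtrace_block_units_mul_tr 1 2 D1 D2 a b 1 0 isT u1 u2.
  by rewrite scale1r scale0r addr0 -defMab mulr1 mulr0 mul0r addr0.
- apply: (ab_real 2 D2) => //.
  have := @mxtrace_block_units_mul_tr 1 2 D1 D2 a b 0 1 isT u1 u2.
  by rewrite scale1r scale0r add0r -defMab mulr1 mulr0 mul0r add0r.
Qed.

Lemma block_unitN i D : block_unit i D -> block_unit i (- D).
Proof.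
case=> AD rD tD FD DD; split.
- exact: oppA.
- exact: mxOver_realN.
- by rewrite linearN /= tD.
- by rewrite mulmxN FD.
- by rewrite mulmxN mulNmx opprK.
Qed.

(** Each unit may be replaced by its opposite. The signs are chosen so that the coordinates can
    later be identified with values of [sqrtC], which is nonnegative on nonnegative arguments. *)
Lemma skew_decomposition :
  exists D1 D2 a1 a2 b1 b2,
  [/\ block_unit 1 D1, block_unit 2 D2,
      S1 = a1 *: D1 + a2 *: D2, S2 = b1 *: D1 + b2 *: D2 &
  [/\ b1 \is Num.real, b2 \is Num.real,
      0 <= a1, 0 <= a2 & (a1 = 0 -> 0 <= b1) /\ (a2 = 0 -> 0 <= b2)]].
Proof.
have [D1 [D2 [u1 u2]]] := ex_block_units.
have [a1 [a2 [ra1 ra2 def1]]] := skew_span_units u1 u2 S1A S1real S1skew.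
have [b1 [b2 [rb1 rb2 def2]]] := skew_span_units u1 u2 S2A S2real S2skew.
have [e1 e1P [ea1 eb1]] := real_ex_sign ra1 rb1.
have [e2 e2P [ea2 eb2]] := real_ex_sign ra2 rb2.
have eZ e i D : e = 1 \/ e = -1 -> block_unit i D -> block_unit i (e *: D).
  by case=> ->; rewrite ?scale1r // scaleN1r; apply: block_unitN.
have ereal (e b : C) : e = 1 \/ e = -1 -> b \is Num.real -> e * b \is Num.real.
  by case=> ->; rewrite ?mul1r ?mulN1r ?rpredN.
have eK (e a : C) (D : 'M[C]_n) : e = 1 \/ e = -1 -> (e * a) *: (e *: D) = a *: D.
  by case=> ->; rewrite ?mul1r ?scale1r // mulN1r scaleN1r scaleNr scalerN opprK.
exists (e1 *: D1), (e2 *: D2), (e1 * a1), (e2 * a2), (e1 * b1), (e2 * b2).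
split; [exact: eZ | exact: eZ | | | split=> //; exact: ereal].
  by rewrite !eK.
by rewrite !eK.
Qed.

(** The spectral projections of [D1] and [D2]: indices 1 and 2 belong to the eigenvalue ['i],
    indices 4 and 3 to [- 'i], in the order of the rows of [skew_eigenmatrix]. *)
Definition skew_idempotent (D1 D2 : 'M[C]_n) : 'I_5 -> 'M[C]_n :=
  tnth [tuple F 0; 2^-1 *: (F 1 - 'i *: D1); 2^-1 *: (F 2 - 'i *: D2);
              2^-1 *: (F 2 + 'i *: D2); 2^-1 *: (F 1 + 'i *: D1)].

(** Within a block, [F i] and [D] multiply like 1 and a square root of -1. *)
Lemma idem_block i D (z w : C) : block_unit i D ->
  (F i + z *: D) *m (F i + w *: D) = (1 - z * w) *: F i + (z + w) *: D.
Proof.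
case=> AD _ _ FD DD; rewrite mulmxDl !mulmxDr -!scalemxAl -!scalemxAr FD F_idem.
rewrite -F_central // FD DD !scalerN scalerA scalerBl scale1r scalerDl.
by rewrite [z *: D - _]addrC addrACA [w *: D + _]addrC.
Qed.

Lemma idem_block_orth i j D D' (z w : C) : i != j ->
  block_unit i D -> F j *m D' = D' ->
  (F i + z *: D) *m (F j + w *: D') = 0.
Proof.
move=> ij [AD _ _ FD _] FD'.
have FD0 : D *m F j = 0.
  by rewrite -F_central // -FD mulmxA F_orth 1?eq_sym // mul0mx.
rewrite -FD' mulmxDl !mulmxDr -!scalemxAl -!scalemxAr !mulmxA FD0 F_orth //.
by rewrite !mul0mx !scaler0 !addr0.
Qed.

(** Within a block, [idem_block] is applied with [z] and [w] among ['i] and [- 'i]: equal values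
    double the factor, opposite ones annihilate it. Products across blocks vanish. *)
Lemma skew_idempotent_orth D1 D2 : block_unit 1 D1 -> block_unit 2 D2 ->
  forall k l, skew_idempotent D1 D2 k *m skew_idempotent D1 D2 l =
    (k == l)%:R *: skew_idempotent D1 D2 k.
Proof.
move=> u1 u2.
have [_ _ _ FD1 _] := u1; have [_ _ _ FD2 _] := u2.
have F0D i D (z : C) : i != 0 -> F i *m D = D -> F 0 *m (F i + z *: D) = 0.
  move=> i0 FD; rewrite -FD mulmxDr -scalemxAr mulmxA F_orth 1?eq_sym //.
  by rewrite mul0mx scaler0 addr0.
have FD0 i D (z : C) : i != 0 -> block_unit i D -> (F i + z *: D) *m F 0 = 0.
  move=> i0 [AD _ _ FD _]; rewrite -F_central ?F0D //.
  by apply: addA => //; apply: scaleA.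
have ii : 'i * 'i = -1 :> C by rewrite -expr2 sqrCi.
(* The shape that [idem_block] gives to the square of a half-sum once [z * z] is evaluated to -1. *)
have half (z : C) (M N : 'M[C]_n) :
    2^-1 *: (2^-1 *: ((1 + 1) *: M + (z + z) *: N)) = 2^-1 *: (M + z *: N).
  rewrite !scalerDl !scale1r addrACA -mulr2n -scaler_nat.
  by rewrite [2^-1 *: (2 *: _)]scalerA mulVf ?scale1r // pnatr_eq0.
case=> [[|[|[|[|[|//]]]]] lk] [[|[|[|[|[|//]]]]] ll];
  rewrite /skew_idempotent !(tnth_nth 0) /= -?scaleNr;
  rewrite -?scalemxAl -?scalemxAr ?scale0r ?scale1r ?F_idem //.
all: rewrite ?F0D ?FD0 ?(idem_block _ _ u1) ?(idem_block _ _ u2)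
  ?(idem_block_orth _ _ _ u1 FD2) ?(idem_block_orth _ _ _ u2 FD1) ?scaler0 //.
all: rewrite ?mulrNN ?mulrN ?mulNr ?ii ?opprK ?subrr ?addNr ?scale0r ?addr0 ?scaler0 //.
all: exact: half.
Qed.

(** [D1] and [D2] act as ['i] or [- 'i] on the projections of their own blocks, whence the
    coefficients. *)
Lemma skew_idempotent_sum D1 D2 (c0 x1 y1 x2 y2 : C) :
  c0 *: F 0 + (x1 *: F 1 + y1 *: D1) + (x2 *: F 2 + y2 *: D2) =
  \sum_(k < 5) [:: c0; x1 + 'i * y1; x2 + 'i * y2; x2 - 'i * y2; x1 - 'i * y1]`_k
     *: skew_idempotent D1 D2 k.
Proof.
have ii : 'i * 'i = -1 :> C by rewrite -expr2 sqrCi.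
have pair (x y : C) (P D : 'M[C]_n) : x *: P + y *: D =
    (x + 'i * y) *: (2^-1 *: (P - 'i *: D)) + (x - 'i * y) *: (2^-1 *: (P + 'i *: D)).
  rewrite -scaleNr !scalerDr !scalerA addrACA -!scalerDl.
  congr (_ *: _ + _ *: _); first by field.
  transitivity (- ('i * 'i) * y); [by rewrite ii opprK mul1r | by field].
rewrite (pair x1) (pair x2) !big_ord_recl big_ord0 addr0.
rewrite /skew_idempotent !(tnth_nth 0) /= -!addrA; congr (_ + (_ + _)).
by rewrite addrC -!addrA.
Qed.

Lemma skew_idempotentA D1 D2 : A D1 -> A D2 -> forall k, A (skew_idempotent D1 D2 k).
Proof.
move=> AD1 AD2; case=> [[|[|[|[|[|//]]]]] lk];
  by rewrite /skew_idempotent (tnth_nth 0) /= -?scaleNr //;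
     apply: scaleA; apply: addA => //; apply: scaleA.
Qed.

(** If [F i + z *: D] vanished, so would its transpose [F i - z *: D], and their sum is twice
    [F i]. *)
Lemma skew_idempotent_neq0 D1 D2 : block_unit 1 D1 -> block_unit 2 D2 ->
  forall k, skew_idempotent D1 D2 k != 0.
Proof.
have neq0 i D (z : C) : block_unit i D -> 2^-1 *: (F i + z *: D) != 0.
  move=> [_ _ tD _ _]; rewrite scaler_eq0 invr_eq0 pnatr_eq0 /=.
  apply: contra_neq (F_neq0 i) => e0; have := congr1 trmx e0.
  rewrite linearD linearZ /= Fsym tD scalerN trmx0 => e1.
  have /eqP : F i *+ 2 = 0 by rewrite mulr2n -[0]addr0 -{1}e0 -e1 addrACA subrr addr0.
  by rewrite -scaler_nat scaler_eq0 pnatr_eq0 => /eqP.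
move=> u1 u2; case=> [[|[|[|[|[|//]]]]] lk];
  by rewrite /skew_idempotent (tnth_nth 0) /= -?scaleNr ?neq0.
Qed.

End SkewAlgebra.

(** * Adjacency matrices and closure properties of the Bose-Mesner algebra *)

Section BoseMesner.

Variables (C : numClosedFieldType) (X : finType) (d : nat).
Variable R : 'I_d.+1 -> {set X * X}.
Implicit Types M N : 'M[C]_#|X|.

Lemma bm_add M N : in_bose_mesner R M -> in_bose_mesner R N ->
  in_bose_mesner R (M + N).
Proof.
move=> [c ->] [c' ->]; exists (fun i => c i + c' i).
by rewrite -big_split; apply: eq_bigr => i _; rewrite scalerDl.
Qed.

Lemma bm_scale a M : in_bose_mesner R M -> in_bose_mesner R (a *: M).
Proof.
move=> [c ->]; exists (fun i => a * c i).
by rewrite scaler_sumr; apply: eq_bigr => i _; rewrite scalerA.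
Qed.

Lemma bm_sum (I : Type) (s : seq I) (M : I -> 'M[C]_#|X|) :
  (forall i, in_bose_mesner R (M i)) -> in_bose_mesner R (\sum_(i <- s) M i).
Proof.
move=> MA; elim/big_ind: _ => //; last exact: bm_add.
by exists (fun=> 0); rewrite big1 // => i _; rewrite scale0r.
Qed.

Lemma bm_adjmx i : in_bose_mesner R (adjmx C (R i)).
Proof.
exists (fun j => (j == i)%:R); rewrite (bigD1 i) //= eqxx scale1r big1 ?addr0 //.
by move=> j /negPf ->; rewrite scale0r.
Qed.

Lemma adjmx_tr (S : {set X * X}) : (adjmx C S)^T = adjmx C (transpose_rel S).
Proof. by apply/matrixP => i j; rewrite !mxE inE. Qed.

Lemma adjmxU (S T : {set X * X}) : [disjoint S & T] ->
  adjmx C (S :|: T) = adjmx C S + adjmx C T.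
Proof.
move=> dST; apply/matrixP => i j; rewrite !mxE inE.
case: (boolP (_ \in S)) => [pS|_]; last by rewrite add0r.
by rewrite (disjointFr dST pS) addr0.
Qed.

(** The difference has entries 0, 1 and -1, with support the union. *)
Lemma adjmxB_sqr (S T : {set X * X}) i j : [disjoint S & T] ->
  (adjmx C S - adjmx C T) i j * (adjmx C S - adjmx C T) i j
    = (adjmx C S + adjmx C T) i j.
Proof.
move=> dST; rewrite !mxE; case: (boolP (_ \in S)) => [pS|_].
  by rewrite (disjointFr dST pS) subr0 addr0 mulr1.
by rewrite !add0r mulrNN -natrM mulnb andbb.
Qed.

Lemma adjmx_real (S : {set X * X}) : adjmx C S \is a mxOver Num.real.
Proof. by apply/mxOverP => i j; rewrite mxE realn. Qed.

Lemma adjmxM_entry (S T : {set X * X}) i j :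
  (adjmx C S *m adjmx C T) i j =
  #|[set z | ((enum_val i, z) \in S) && ((z, enum_val j) \in T)]|%:R.
Proof.
rewrite mxE -sum1_card natr_sum (reindex (@enum_val X X)) /=; last first.
  by apply: onW_bij; exact: enum_val_bij.
rewrite [RHS]big_mkcond; apply: eq_bigr => k _; rewrite !mxE inE.
by rewrite -natrM mulnb; case: (_ && _).
Qed.

Hypothesis hR : assoc_scheme R.

Lemma scheme_disjoint i j : i != j -> [disjoint R i & R j].
Proof.
case: hR => _ [injR /and3P[_ /trivIsetP tI _]] _ _ ij.
by apply: tI; rewrite ?imset_f // inj_eq.
Qed.

Lemma scheme_cover p : exists i, p \in R i.
Proof.
case: hR => _ [_ /and3P[/eqP cov _ _]] _ _.
have : p \in cover [set R i | i : 'I_d.+1] by rewrite cov inE.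
by case/bigcupP => _ /imsetP[i _ ->] pR; exists i.
Qed.

Lemma scheme_neq0 i : R i != set0.
Proof.
case: hR => _ [_ /and3P[_ _ n0]] _ _; apply: contraNneq n0 => <-.
exact: imset_f.
Qed.

Lemma scheme_uniq p i j : p \in R i -> (p \in R j) = (j == i).
Proof.
move=> pRi; have [->//|ji] := eqVneq j i.
by rewrite (disjointFl (scheme_disjoint ji) pRi).
Qed.

Lemma sum_coef_adjmx_entry (c : 'I_d.+1 -> C) k x y :
  (enum_val x, enum_val y) \in R k -> (\sum_i c i *: adjmx C (R i)) x y = c k.
Proof.
move=> Rk; rewrite summxE (bigD1 k) //= big1 => [|i ik].
  by rewrite !mxE Rk mulr1 addr0.
by rewrite !mxE (scheme_uniq i Rk) (negPf ik) mulr0.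
Qed.

Lemma adjmx0 : adjmx C (R ord0) = 1%:M.
Proof.
case: hR => -> _ _ _; apply/matrixP => i j; rewrite !mxE inE /=.
by rewrite (inj_eq enum_val_inj).
Qed.

Lemma sum_adjmx : \sum_i adjmx C (R i) = const_mx 1.
Proof.
apply/matrixP => x y; have [k Rk] := scheme_cover (enum_val x, enum_val y).
rewrite mxE -(sum_coef_adjmx_entry (fun=> 1) Rk); congr (fun_of_matrix _ x y).
by apply: eq_bigr => i _; rewrite scale1r.
Qed.

(** The intersection numbers are the structure constants of the product. *)
Lemma bm_mul M N : in_bose_mesner R M -> in_bose_mesner R N ->
  in_bose_mesner R (M *m N).
Proof.
move=> [c ->] [c' ->]; rewrite mulmx_suml; apply: bm_sum => i.
rewrite mulmx_sumr; apply: bm_sum => j; rewrite -scalemxAl -scalemxAr.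
do 2!apply: bm_scale; case: hR => _ _ _ /(_ i j)/fin_all_exists[p pP].
exists (fun k => (p k)%:R); apply/matrixP => x y.
have [k Rk] := scheme_cover (enum_val x, enum_val y).
by rewrite (sum_coef_adjmx_entry _ Rk) adjmxM_entry (pP k).
Qed.

Lemma bm_tr M : in_bose_mesner R M -> in_bose_mesner R M^T.
Proof.
move=> [c ->]; rewrite linear_sum; apply: bm_sum => i /=; rewrite linearZ /=.
by apply: bm_scale; case: hR => _ _ /(_ i)[i' ei'] _; rewrite adjmx_tr ei'; apply: bm_adjmx.
Qed.

Lemma card_scheme_gt0 : (0 < #|X|)%N.
Proof. by have /set0Pn[[x y] _] := scheme_neq0 ord0; apply/card_gt0P; exists x. Qed.

Lemma adjmx_neq0 i : adjmx C (R i) != 0.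
Proof.
have /set0Pn[[x y] Rxy] := scheme_neq0 i; apply/eqP => /matrixP.
move=> /(_ (enum_rank x) (enum_rank y))/eqP.
by rewrite !mxE !enum_rankK Rxy oner_eq0.
Qed.

End BoseMesner.

(** * Recognizing the primitive idempotents *)

(** The eigenmatrix shows that the orthogonal idempotents [E i] span the algebra, so every
    idempotent is a sum of some of them, and the primitive ones are the sums with a single term. *)
Lemma idempotent_ordering_basis (C : numClosedFieldType) (X : finType) (d : nat)
    (R : 'I_d.+1 -> {set X * X}) (E : 'I_d.+1 -> 'M[C]_#|X|) (P : 'M[C]_d.+1) :
    is_eigenmatrix R E P ->
    (forall i, in_bose_mesner R (E i)) ->
    (forall i j, E i *m E j = (i == j)%:R *: E i) ->
    (forall i, E i != 0) ->
    E ord0 = const_mx (#|X|%:R^-1) ->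
  idempotent_ordering R E.
Proof.
move=> eigP AE orthE E_neq0 E0.
have mulE i (c : 'I_d.+1 -> C) : E i *m \sum_j c j *: E j = c i *: E i.
  rewrite mulmx_sumr (bigD1 i) //= -scalemxAr orthE eqxx scale1r big1 ?addr0 //.
  by move=> j ji; rewrite -scalemxAr orthE eq_sym (negPf ji) scale0r scaler0.
have mulEr i (c : 'I_d.+1 -> C) : (\sum_j c j *: E j) *m E i = c i *: E i.
  rewrite mulmx_suml (bigD1 i) //= -scalemxAl orthE eqxx scale1r big1 ?addr0 //.
  by move=> j ji; rewrite -scalemxAl orthE (negPf ji) scale0r scaler0.
have spanE M : in_bose_mesner R M -> exists c : 'I_d.+1 -> C, M = \sum_j c j *: E j.
  move=> [c ->]; exists (fun i => \sum_j c j * P i j).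
  under eq_bigr => j _ do rewrite eigP scaler_sumr.
  rewrite exchange_big; apply: eq_bigr => i _; rewrite scaler_suml.
  by apply: eq_bigr => j _; rewrite scalerA.
have idemE M : bm_idempotent R M -> exists2 c : 'I_d.+1 -> C,
    M = \sum_j c j *: E j & forall i, c i = 0 \/ c i = 1.
  case=> /spanE[c defM] MM; exists c => // i.
  have : (c i * c i - c i) *: E i = 0.
    have EM : c i *: E i = E i *m M by rewrite defM mulE.
    by rewrite scalerBl -scalerA !EM scalemxAl EM -mulmxA MM subrr.
  move=> /eqP; rewrite scaler_eq0 (negPf (E_neq0 i)) orbF -{3}[c i]mulr1 -mulrBr.
  by rewrite mulf_eq0 subr_eq0 => /orP[]/eqP; [left|right].
have injE : injective E.
  move=> i j eij; apply/eqP; have := E_neq0 i; apply: contraNT => ij.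
  by have := orthE i j; rewrite -eij orthE eqxx (negPf ij) scale1r scale0r => ->.
have idE i : bm_idempotent R (E i) by split; rewrite ?orthE ?eqxx ?scale1r.
split=> // M; split=> [[idM M_neq0 primM]|[i ->]].
  have [c defM c01] := idemE _ idM.
  have /existsP[i /eqP ci1] : [exists i, c i == 1].
    apply: contra_notT M_neq0; rewrite negb_exists => /forallP c_neq1.
    rewrite defM big1 // => i _; have [->|ci1] := c01 i; first by rewrite scale0r.
    by have := c_neq1 i; rewrite ci1 eqxx.
  have EM : E i *m M = E i by rewrite defM mulE ci1 scale1r.
  have ME : M *m E i = E i by rewrite defM mulEr ci1 scale1r.
  have EE : E i *m E i = E i by rewrite orthE eqxx scale1r.
  (* Primitivity is tested on the splitting of [M] into [E i] and [M - E i]. *)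
  exists i; have [||||/eqP|/eqP] := primM (E i) (M - E i) (idE i).
  - split.
      by rewrite -scaleN1r; apply: bm_add; [case: idM|apply: bm_scale].
    by rewrite mulmxBl !mulmxBr EM ME EE subrr subr0; case: idM => _ ->.
  - by rewrite mulmxBr EM EE subrr.
  - by rewrite mulmxBl ME EE subrr.
  - by rewrite addrC subrK.
  - by rewrite (negPf (E_neq0 i)).
  - by rewrite subr_eq0 => /eqP.
split=> // [|G H idG idH GH _ defE]; first exact/eqP.
(* Conversely, a summand [G] of [E i] satisfies [G = G *m E i], a multiple of [E i] by 0 or 1. *)
have [c defG c01] := idemE _ idG.
have : G *m E i = G by rewrite defE mulmxDr GH addr0; case: idG.
rewrite {1}defG mulEr; have [->|->] := c01 i; first by rewrite scale0r; left.
rewrite scale1r => eG; right; move/eqP: defE.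
by rewrite eG -subr_eq0 opprD addNKr oppr_eq0 => /eqP.
Qed.

(** * The case analysis on eigenvalues *)

Lemma conj_rect_half (C : numClosedFieldType) (v b : C) :
  v \is Num.real -> b \is Num.real -> ((v + 'i * b) / 2)^* = (v - 'i * b) / 2.
Proof.
move=> rv rb; rewrite rmorphM rmorphD rmorphM /= conjCi fmorphV rmorph_nat /=.
by rewrite (conj_Creal rv) (conj_Creal rb) mulNr.
Qed.

(** The three relations make the rows [(a1, a2)] and [(b1, b2)], suitably scaled, orthonormal; then
    so are the columns, which is what case (iii) asserts. A zero among [a1], [a2] leads to the first
    two cases. *)
Lemma eigenvalue_cases (C : numClosedFieldType)
    (n k1 k2 m1 m2 r s t u a1 a2 b1 b2 : C) :
    0 < n -> 0 < k1 -> 0 < k2 -> 0 < m1 -> 0 < m2 ->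
    t \is Num.real -> u \is Num.real ->
    b1 \is Num.real -> b2 \is Num.real -> 0 <= a1 -> 0 <= a2 ->
    (a1 = 0 -> 0 <= b1) -> (a2 = 0 -> 0 <= b2) ->
    a1 * a1 * m1 + a2 * a2 * m2 = n * k1 ->
    b1 * b1 * m1 + b2 * b2 * m2 = n * k2 ->
    a1 * b1 * m1 + a2 * b2 * m2 = 0 ->
  let rho := (r + 'i * a1) / 2 in let tau := (t + 'i * b1) / 2 in
  let sigma := (s + 'i * a2) / 2 in let omega := (u + 'i * b2) / 2 in
  [\/ case_i n k1 k2 m1 m2 r s t u rho tau sigma omega,
      case_ii n k1 k2 m1 m2 r s t u rho tau sigma omega,
      case_iii n k1 k2 m1 m2 r s t u rho tau sigma omega |
      case_iii n k1 k2 m1 m2 r s t u rho tau^* sigma omega^*].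
Proof.
move=> n_gt0 k1_gt0 k2_gt0 m1_gt0 m2_gt0 rt ru rb1 rb2 a1_ge0 a2_ge0 b1_ge0 b2_ge0.
move=> eq1 eq2 eq12 rho tau sigma omega.
have [nz k1z k2z m1z m2z] : [/\ n != 0, k1 != 0, k2 != 0, m1 != 0 & m2 != 0].
  by split; rewrite gt_eqF.
have sq_sqrt (a x : C) : 0 <= a -> a * a = x -> a = sqrtC x.
  by move=> a_ge0 <-; rewrite -expr2 sqrCK.
have [a20|a2z] := eqVneq a2 0.
  have a1z : a1 != 0.
    apply: contra_eq_neq eq1 => ->; rewrite a20 !mul0r addr0 eq_sym.
    by rewrite mulf_neq0.
  have b10 : b1 = 0.
    move/eqP: eq12; rewrite a20 !mul0r addr0 !mulf_eq0 (negPf a1z) (negPf m1z).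
    by rewrite orbF => /eqP.
  constructor 1; split; rewrite /sigma /tau /rho /omega /sqrtN ?a20 ?b10 ?mulr0 ?addr0 //.
    rewrite -(sq_sqrt a1) // -eq1 a20 !mul0r addr0; by field.
  rewrite -(sq_sqrt b2) ?b2_ge0 // -eq2 b10 !mul0r add0r; by field.
have [a10|a1z] := eqVneq a1 0.
  have b20 : b2 = 0.
    move/eqP: eq12; rewrite a10 !mul0r add0r !mulf_eq0 (negPf a2z) (negPf m2z).
    by rewrite orbF => /eqP.
  constructor 2; split; rewrite /sigma /tau /rho /omega /sqrtN ?a10 ?b20 ?mulr0 ?addr0 //.
    rewrite -(sq_sqrt a2) // -eq1 a10 !mul0r add0r; by field.
  rewrite -(sq_sqrt b1) ?b1_ge0 // -eq2 b20 !mul0r addr0; by field.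
have a1_gt0 : 0 < a1 by rewrite lt_def a1z.
have a2_gt0 : 0 < a2 by rewrite lt_def a2z.
(* [detE] is Lagrange's identity for the determinant [p]; the product [0 * 0] is there to be
   rewritten by [eq12] into the square of the inner product. *)
pose p := a1 * b2 - a2 * b1.
have detE : m1 * m2 * (p * p) = n * n * (k1 * k2).
  have -> : n * n * (k1 * k2) = (n * k1) * (n * k2) - 0 * 0 by ring.
  by rewrite -eq1 -eq2 -{1}eq12 -{1}eq12 /p; ring.
have e12 : a1 * b1 * m1 = - (a2 * b2 * m2) by apply/eqP; rewrite -addr_eq0 eq12.
have col1 : a1 * a1 / k1 + b1 * b1 / k2 = n / m1.
  have h : n * (a1 * a1 * k2 + b1 * b1 * k1) = m2 * (p * p).
    have -> : n * (a1 * a1 * k2 + b1 * b1 * k1)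
            = a1 * a1 * (n * k2) + b1 * b1 * (n * k1) by ring.
    rewrite -eq1 -eq2 /p.
    (* Isolates the factor [a1 * b1 * m1]; replacing it by [e12] completes the square [p * p]. *)
    have -> : a1 * a1 * (b1 * b1 * m1 + b2 * b2 * m2) +
              b1 * b1 * (a1 * a1 * m1 + a2 * a2 * m2)
      = 2 * (a1 * b1) * (a1 * b1 * m1) + m2 * (a1 * a1 * b2 * b2 + b1 * b1 * a2 * a2)
      by ring.
    by rewrite e12; ring.
  apply: (mulfI (_ : n * m1 * (k1 * k2) != 0)); first by rewrite !mulf_neq0.
  transitivity (m1 * (n * (a1 * a1 * k2 + b1 * b1 * k1))).
    by field; rewrite k1z k2z.
  by rewrite h mulrA detE; field.
have col2 : a2 * a2 / k1 + b2 * b2 / k2 = n / m2.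
  have h : n * (a2 * a2 * k2 + b2 * b2 * k1) = m1 * (p * p).
    have -> : n * (a2 * a2 * k2 + b2 * b2 * k1)
            = a2 * a2 * (n * k2) + b2 * b2 * (n * k1) by ring.
    rewrite -eq1 -eq2 /p.
    have -> : a2 * a2 * (b1 * b1 * m1 + b2 * b2 * m2) +
              b2 * b2 * (a1 * a1 * m1 + a2 * a2 * m2)
      = - (2 * (a2 * b2) * - (a2 * b2 * m2)) + m1 * (a1 * a1 * b2 * b2 + b1 * b1 * a2 * a2)
      by ring.
    by rewrite -e12; ring.
  apply: (mulfI (_ : n * m2 * (k1 * k2) != 0)); first by rewrite !mulf_neq0.
  transitivity (m2 * (n * (a2 * a2 * k2 + b2 * b2 * k1))).
    by field; rewrite k1z k2z.
  by rewrite h mulrA [m2 * m1]mulrC detE; field.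
have col12 : a1 * a2 / k1 + b1 * b2 / k2 = 0.
  apply: (mulfI (_ : n * (k1 * k2) != 0)); first by rewrite !mulf_neq0.
  transitivity (a1 * a2 * (n * k2) + b1 * b2 * (n * k1)).
    by field; rewrite k1z k2z.
  rewrite -eq1 -eq2.
  (* The inner product of the rows splits off as a factor. *)
  have -> : a1 * a2 * (b1 * b1 * m1 + b2 * b2 * m2) +
            b1 * b2 * (a1 * a1 * m1 + a2 * a2 * m2) =
    (a2 * b1 + a1 * b2) * (a1 * b1 * m1 + a2 * b2 * m2) by ring.
  by rewrite eq12 !mulr0.
(* Since [a1] and [a2] are positive, orthogonal columns force [b1] and [b2] to have opposite signs;
   hence the minus sign in [omega]. *)
have bb_lt0 : b1 * b2 < 0.
  have -> : b1 * b2 = - (a1 * a2 / k1) * k2.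
    by apply: (divIf k2z); rewrite mulfK //; apply/eqP; rewrite -addr_eq0 addrC col12.
  by rewrite mulNr oppr_lt0 !mulr_gt0 ?invr_gt0.
have b1z : b1 != 0 by apply: contraTneq bb_lt0 => ->; rewrite mul0r ltxx.
(* Here [x] and [y] stand for the absolute values of [b1] and [b2]. *)
have iii (x y : C) : 0 < x -> 0 < y -> x * x = b1 * b1 -> y * y = b2 * b2 ->
    x * y = - (b1 * b2) ->
    case_iii n k1 k2 m1 m2 r s t u rho ((t + 'i * x) / 2) sigma ((u - 'i * y) / 2).
  move=> x_gt0 y_gt0 xx yy xy.
  exists (a2 * a2), (y * y), (a1 * a1), (x * x); split; first by split; apply: mulr_gt0.
    by split; rewrite /sqrtN -!expr2 !sqrCK ?ltW.
  split; rewrite ?xx ?yy //.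
  rewrite -xx -yy -[a2 * a2 * _]mulrACA -[y * y * _]mulrACA -!expr2 !sqrCK ?mulr_ge0 ?ltW //.
  by rewrite [y * x]mulrC xy mulNr opprK [a2 * a1]mulrC.
(* A negative [b1] is made positive by conjugating [tau] and [omega]. *)
have [b1_gt0|b1_lt0|b10] := real_ltgtP (real0 _) rb1; last by rewrite b10 eqxx in b1z.
  have b2_lt0 : b2 < 0 by move: bb_lt0; rewrite pmulr_rlt0.
  constructor 3; have -> : omega = (u - 'i * - b2) / 2 by rewrite mulrN opprK.
  by apply: iii; rewrite ?oppr_gt0 ?mulrNN ?mulrN.
have b2_gt0 : 0 < b2 by move: bb_lt0; rewrite nmulr_rlt0.
constructor 4; rewrite !conj_rect_half //.
have -> : (t - 'i * b1) / 2 = (t + 'i * - b1) / 2 by rewrite mulrN.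
by apply: iii; rewrite ?oppr_gt0 ?mulrNN ?mulNr.
Qed.

(** * Small sums and traces of differences of adjacency matrices *)

Lemma addr3ACA (V : nmodType) (a b c a' b' c' : V) :
  a + b + c + (a' + b' + c') = a + a' + (b + b') + (c + c').
Proof. by rewrite addrACA [a + b + _]addrACA. Qed.

Lemma big_ord3 (V : nmodType) (f : 'I_3 -> V) : \sum_i f i = f 0 + f 1 + f 2.
Proof.
rewrite !big_ord_recl big_ord0 addr0 addrA.
by congr (f _ + f _ + f _); apply: val_inj.
Qed.

Lemma ord3P (i : 'I_3) : [\/ i = 0, i = 1 | i = 2].
Proof.
case: i => [[|[|[|//]]] lti];
  by [constructor 1; apply: val_inj | constructor 2; apply: val_inj
     | constructor 3; apply: val_inj].
Qed.

Lemma big_ord5 (V : nmodType) (f : 'I_5 -> V) :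
  \sum_i f i = f 0 + f 1 + f 2 + f 3 + f 4.
Proof.
rewrite !big_ord_recl big_ord0 addr0 !addrA.
by congr (f _ + f _ + f _ + f _ + f _); apply: val_inj.
Qed.

(** The product has constant entries, so it is symmetric as well as skew. *)
Lemma const_mx_skew0 (K : numFieldType) (n : nat) (a : K) (M : 'M[K]_n) :
  M^T = - M -> const_mx a *m M *m const_mx a = 0 :> 'M_n.
Proof.
move=> tM; set N := _ *m _.
have tN : N^T = N.
  apply/matrixP => i j; rewrite !mxE; apply: eq_bigr => k _; rewrite !mxE.
  by congr (_ * _); apply: eq_bigr => l _; rewrite !mxE.
have skN : N^T = - N by rewrite /N !trmx_mul trmx_const tM mulNmx mulmxN mulmxA.
have /eqP : N *+ 2 = 0 by rewrite mulr2n -{1}tN skN addNr.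
by rewrite -scaler_nat scaler_eq0 pnatr_eq0 => /eqP.
Qed.

(** Both sides count the pairs in the union. The right side involves the idempotent [J / n], on
    which the union acts by its valency. *)
Lemma mxtrace_adjmxB (C : numClosedFieldType) (X : finType) (S T : {set X * X}) :
  [disjoint S & T] ->
  \tr ((adjmx C S - adjmx C T) *m (adjmx C S - adjmx C T)^T) =
  #|X|%:R * \tr (adjmx C (S :|: T) *m const_mx #|X|%:R^-1).
Proof.
move=> dST; rewrite mxtrace_mul_tr mulr_sumr; apply: eq_bigr => i _.
rewrite mxE mulr_sumr; apply: eq_bigr => j _; rewrite (adjmxB_sqr C i j dST).
rewrite adjmxU // [const_mx _ _ _]mxE mulrC mulfVK //.
by rewrite pnatr_eq0 -lt0n; apply: leq_ltn_trans (ltn_ord i).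
Qed.

Lemma mxtrace_adjmxB_orth (C : numClosedFieldType) (X : finType)
    (S T S' T' : {set X * X}) :
  [disjoint S & S'] -> [disjoint S & T'] -> [disjoint T & S'] -> [disjoint T & T'] ->
  \tr ((adjmx C S - adjmx C T) *m (adjmx C S' - adjmx C T')^T) = 0.
Proof.
move=> d1 d2 d3 d4; rewrite mxtrace_mul_tr big1 // => i _; rewrite big1 // => j _.
rewrite !mxE; case: (boolP (_ \in S)) => [pS|_].
  by rewrite (disjointFr d1 pS) (disjointFr d2 pS) subrr mulr0.
case: (boolP (_ \in T)) => [pT|_]; last by rewrite subrr mul0r.
by rewrite (disjointFr d3 pT) (disjointFr d4 pT) subrr mulr0.
Qed.

Lemma transpose_relK (X : finType) : involutive (@transpose_rel X).
Proof. by move=> S; apply/setP => -[x y]; rewrite !inE. Qed.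

(* Interchanging the names R_2 and R_3 conjugates tau and omega and preserves
   every hypothesis, so the sign pattern in case (iii) is fixed only up to this
   interchange; hence the last disjunct. *)
Theorem theorem3p1 (C : numClosedFieldType) (X : finType)
    (R : 'I_5 -> {set X * X})
    (hR : assoc_scheme R) (hskew : skew_symmetric R)
    (h14 : R 1 = transpose_rel (R 4)) (h23 : R 2 = transpose_rel (R 3))
    (F : 'I_3 -> 'M[C]_#|X|) (k1 k2 r s t u : C) (m1 m2 : nat)
    (hF : idempotent_ordering (symmetrization R) F)
    (hP : is_eigenmatrix (symmetrization R) F (sym_eigenmatrix k1 k2 r s t u))
    (hm1 : \rank (F 1) = m1) (hm2 : \rank (F 2) = m2)
    (hr : 0 <= r) (hs : s < 0) :
  [/\ t = - r - 1,
      u = - s - 1 &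
      exists (E : 'I_5 -> 'M[C]_#|X|) (rho tau sigma omega : C),
      [/\ idempotent_ordering R E,
          is_eigenmatrix R E (skew_eigenmatrix k1 k2 rho tau sigma omega) &
          [\/ case_i #|X|%:R k1 k2 m1%:R m2%:R r s t u rho tau sigma omega,
              case_ii #|X|%:R k1 k2 m1%:R m2%:R r s t u rho tau sigma omega,
              case_iii #|X|%:R k1 k2 m1%:R m2%:R r s t u rho tau sigma omega |
              case_iii #|X|%:R k1 k2 m1%:R m2%:R r s t u
                rho tau^* sigma omega^*]]].
Proof.
have disj := scheme_disjoint hR.
have d14 : [disjoint R 1 & R 4] by exact: disj.
have d23 : [disjoint R 2 & R 3] by exact: disj.
set n : C := #|X|%:R.
have n_gt0 : 0 < n by rewrite ltr0n (card_scheme_gt0 hR).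
have n_neq0 : n != 0 by rewrite gt_eqF.
pose B i := adjmx C (R i).
have tB1 : (B 1)^T = B 4 by rewrite /B adjmx_tr h14 transpose_relK.
have tB4 : (B 4)^T = B 1 by rewrite -tB1 trmxK.
have tB2 : (B 2)^T = B 3 by rewrite /B adjmx_tr h23 transpose_relK.
have tB3 : (B 3)^T = B 2 by rewrite -tB2 trmxK.
have B0 : B 0 = 1%:M by exact: adjmx0.
have symB : (adjmx C (symmetrization R 0) = B 0)
          * (adjmx C (symmetrization R 1) = B 1 + B 4)
          * (adjmx C (symmetrization R 2) = B 2 + B 3).
  by do !split; rewrite /symmetrization (tnth_nth set0) /= ?adjmxU.
have eqI : F 0 + F 1 + F 2 = 1%:M.
  by have := hP 0; rewrite symB B0 big_ord3 !mxE /= !scale1r.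
have eq1 : B 1 + B 4 = k1 *: F 0 + r *: F 1 + s *: F 2.
  by have := hP 1; rewrite symB big_ord3 !mxE.
have eq2 : B 2 + B 3 = k2 *: F 0 + t *: F 1 + u *: F 2.
  by have := hP 2; rewrite symB big_ord3 !mxE.
have F0E : F 0 = const_mx n^-1 by case: hF.
have primF i : primitive_idempotent (symmetrization R) (F i).
  by case: hF => _ /(_ (F i))[_ prim] _; apply: prim; exists i.
have FF i : F i *m F i = F i by case: (primF i) => [[_ ->]].
have F_neq0 i : F i != 0 by case: (primF i) => _ /eqP.
have Fspan i : exists x y z, F i = x *: B 0 + y *: (B 1 + B 4) + z *: (B 2 + B 3).
  case: (primF i) => [[[c ->] _] _ _]; exists (c 0), (c 1), (c 2).
  by rewrite big_ord3 !symB.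
(* [idempotent_ordering] does not state orthogonality; it follows because the three idempotents sum
   to the identity. *)
have Forth i j : F i *m F j = (i == j)%:R *: F i.
  have [<-|ij] := eqVneq i j; first by rewrite FF scale1r.
  have [k sumP] : exists k, F i + F j + F k = 1%:M.
    move: ij; rewrite -eqI; case: (ord3P i) => ->; case: (ord3P j) => -> // _.
    - by exists 2.
    - by exists 1; rewrite addrAC.
    - by exists 2; rewrite [F 1 + _]addrC.
    - by exists 0; rewrite addrC addrA.
    - by exists 1; rewrite addrAC addrC [F 2 + _]addrC addrA.
    - by exists 0; rewrite addrC [F 2 + _]addrC addrA.
  by rewrite scale0r (idem_sum1_orth (FF i) (FF j) (FF k) sumP).
have F_ij i j : i != j -> F i *m F j = 0 by rewrite Forth => /negPf ->; rewrite scale0r.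
have Fsum : \sum_i F i = 1%:M by rewrite big_ord3.
have sumB : \sum_i B i = n *: F 0.
  rewrite /B sum_adjmx // F0E; apply/matrixP => i j; rewrite !mxE.
  by rewrite divff.
(* Two expansions of the all-ones matrix; comparing them on [F 1] and [F 2] shows that the
   nontrivial rows of the eigenmatrix sum to zero. *)
have eqJ : n *: F 0 = (1 + k1 + k2) *: F 0 + (1 + r + t) *: F 1 + (1 + s + u) *: F 2.
  have -> : n *: F 0 = B 0 + (B 1 + B 4) + (B 2 + B 3).
    rewrite -sumB big_ord5 -!addrA; congr (_ + (_ + _)).
    by rewrite addrA addrC.
  rewrite B0 -eqI eq1 eq2 (addr3ACA (F 0) (F 1) (F 2)) (addr3ACA (F 0 + _)).
  by rewrite !scalerDl !scale1r.
have [rt0 su0] : 1 + r + t = 0 /\ 1 + s + u = 0.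
  have := congr1 (mulmx (F 2)) eqJ; have := congr1 (mulmx (F 1)) eqJ.
  rewrite !mulmxDr -!scalemxAr !FF !F_ij // !scaler0 !add0r !addr0.
  move=> /esym/eqP; rewrite scaler_eq0 (negPf (F_neq0 1)) orbF => /eqP -> /esym/eqP.
  by rewrite scaler_eq0 (negPf (F_neq0 2)) orbF => /eqP ->.
have tE : t = - r - 1 by rewrite -[t](addKr (1 + r)) rt0 addr0 opprD addrC.
have uE : u = - s - 1 by rewrite -[u](addKr (1 + s)) su0 addr0 opprD addrC.
have rr : r \is Num.real by rewrite ger0_real.
have rs : s \is Num.real by rewrite ltr0_real.
have rt : t \is Num.real by rewrite tE realB ?realN ?real1.
have ru : u \is Num.real by rewrite uE realB ?realN ?real1.
have trF0 : \tr (F 0) = 1.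
  rewrite F0E /mxtrace (eq_bigr (fun=> n^-1)) => [|i _]; rewrite ?mxE //.
  by rewrite sumr_const card_ord -mulr_natr mulVf.
have trF i : \tr (F i) = (\rank (F i))%:R by rewrite mxtrace_idem.
pose S1 := B 1 - B 4; pose S2 := B 2 - B 3.
have trS1 : \tr (S1 *m S1^T) = n * k1.
  rewrite mxtrace_adjmxB // -F0E adjmxU // [X in X *m _]eq1 !mulmxDl -!scalemxAl.
  by rewrite FF !F_ij // !scaler0 !addr0 linearZ /= trF0 mulr1.
have trS2 : \tr (S2 *m S2^T) = n * k2.
  rewrite mxtrace_adjmxB // -F0E adjmxU // [X in X *m _]eq2 !mulmxDl -!scalemxAl.
  by rewrite FF !F_ij // !scaler0 !addr0 linearZ /= trF0 mulr1.
have trS12 : \tr (S1 *m S2^T) = 0 by apply: mxtrace_adjmxB_orth; apply: disj.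
have tS1 : S1^T = - S1 by rewrite /S1 linearB /= tB1 tB4 opprB.
have tS2 : S2^T = - S2 by rewrite /S2 linearB /= tB2 tB3 opprB.
have rB i : B i \is a mxOver Num.real by exact: adjmx_real.
have rS1 : S1 \is a mxOver Num.real by exact: mxOver_realB.
have rS2 : S2 \is a mxOver Num.real by exact: mxOver_realB.
have diff_neq0 i j : i != j -> B i - B j != 0.
  move=> ij; rewrite subr_eq0; apply: contraNneq (adjmx_neq0 C hR i) => eB.
  have dij := disj _ _ ij; apply/eqP/matrixP => x y.
  have := congr1 (fun M : 'M[C]_#|X| => M x y) eB; rewrite !mxE.
  by case: (boolP (_ \in R i)) => // /(disjointFr dij) ->.
have S1_neq0 : S1 != 0 by exact: diff_neq0.
have S2_neq0 : S2 != 0 by exact: diff_neq0.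
(* Positivity of the valencies is read off from the squared norm of a nonzero real matrix. *)
have k_gt0 (S : 'M[C]_#|X|) k : S \is a mxOver Num.real -> S != 0 ->
    \tr (S *m S^T) = n * k -> 0 < k.
  move=> rS S_neq0 trS; rewrite -(pmulr_rgt0 _ n_gt0) -trS lt_def mxtrace_mul_tr_ge0 //.
  by rewrite andbT; apply: contra_neq S_neq0; apply: mxtrace_mul_tr_eq0.
have k1_gt0 : 0 < k1 by apply: k_gt0 trS1.
have k2_gt0 : 0 < k2 by apply: k_gt0 trS2.
have m_gt0 i : 0 < (\rank (F i))%:R :> C by rewrite ltr0n lt0n mxrank_eq0.
have FA i : in_bose_mesner R (F i).
  have [x [y [z ->]]] := Fspan i.
  by do !apply: bm_add; do ?apply: bm_scale; do ?apply: bm_add; apply: bm_adjmx.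
have Fsym i : (F i)^T = F i.
  have [x [y [z ->]]] := Fspan i.
  rewrite !(linearD, linearZ) /= tB1 tB2 tB3 tB4 B0 trmx1.
  by rewrite [B 4 + _]addrC [B 3 + _]addrC !scalerDr.
have rF0 : F 0 \is a mxOver Num.real.
  by apply/mxOverP => i j; rewrite F0E mxE realV gtr0_real.
have rF1 : F 1 \is a mxOver Num.real.
  have rs_neq0 : r - s != 0 by rewrite gt_eqF // subr_gt0 (lt_le_trans hs).
  (* As [r] and [s] differ, this can be solved for [F 1] with real coefficients. *)
  have e : B 1 + B 4 = k1 *: F 0 + s *: (B 0 - F 0) + (r - s) *: F 1.
    have -> : B 0 - F 0 = F 1 + F 2.
      by rewrite B0 -eqI -[F 0 + F 1 + F 2]addrA [F 0 + _]addrC addrK.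
    rewrite eq1 scalerDr scalerBl -!addrA; congr (_ + _).
    by rewrite [RHS]addrA [RHS]addrC addrA subrK.
  have -> : F 1 = (r - s)^-1 *: (B 1 + B 4 - (k1 *: F 0 + s *: (B 0 - F 0))).
    by rewrite e [_ + (r - s) *: _]addrC addrK scalerA mulVf // scale1r.
  apply: mxOverZ; first by rewrite realV rpredB.
  apply: (mxOver_realB (mxOver_realD (rB _) (rB _))).
  by apply: mxOver_realD; apply: mxOverZ; rewrite ?mxOver_realB // gtr0_real.
have rF2 : F 2 \is a mxOver Num.real.
  have -> : F 2 = B 0 - F 0 - F 1.
    by rewrite B0 -eqI -[F 0 + F 1 + F 2]addrA [F 0 + _]addrC addrK [F 1 + _]addrC addrK.
  by apply: mxOver_realB rF1; apply: mxOver_realB.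
have rF i : F i \is a mxOver Num.real by case: (ord3P i) => ->.
have symA M : in_bose_mesner R M -> M^T = M ->
    exists c : 'I_3 -> C, M = \sum_i c i *: F i.
  move=> [c defM] tM.
  have {tM}-> : M = 2^-1 *: (M + M^T).
    by rewrite tM -mulr2n -scaler_nat scalerA mulVf ?scale1r ?pnatr_eq0.
  pose f1 := c 1 + c 4; pose f2 := c 2 + c 3.
  (* [M] is averaged with its transpose, and the columns of the symmetric eigenmatrix are
     substituted. *)
  exists (tnth [tuple c 0 + 2^-1 * (f1 * k1) + 2^-1 * (f2 * k2);
                      c 0 + 2^-1 * (f1 * r) + 2^-1 * (f2 * t);
                      c 0 + 2^-1 * (f1 * s) + 2^-1 * (f2 * u)]).
  have -> : M + M^T = (2 * c 0) *: B 0 + f1 *: (B 1 + B 4) + f2 *: (B 2 + B 3).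
    rewrite defM linear_sum -big_split big_ord5 /= !linearZ /= -!/(B _).
    rewrite tB1 tB2 tB3 tB4 B0 trmx1 -!scalerDr [B 4 + _]addrC [B 3 + _]addrC.
    rewrite /f1 /f2 !scalerDl -mulr2n -scaler_nat scalerA [c 0 * _]mulrC -!addrA.
    by congr (_ + (_ + _)); rewrite addrA addrC.
  rewrite big_ord3 !(tnth_nth 0) /= !scalerDr !scalerA mulrA mulVf ?pnatr_eq0 // mul1r.
  rewrite B0 -eqI -!scalerDr eq1 eq2 !scalerDr !scalerDl !scalerA !mulrA.
  by rewrite (addr3ACA (c 0 *: F 0) (c 0 *: F 1) (c 0 *: F 2)) (addr3ACA (c 0 *: F 0 + _)).
have skewA M : in_bose_mesner R M -> M^T = - M -> exists x y, M = x *: S1 + y *: S2.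
  move=> [c defM] tM.
  have {tM}-> : M = 2^-1 *: (M - M^T).
    by rewrite tM opprK -mulr2n -scaler_nat scalerA mulVf ?scale1r ?pnatr_eq0.
  exists (2^-1 * (c 1 - c 4)), (2^-1 * (c 2 - c 3)).
  rewrite -!scalerA -scalerDr; congr (_ *: _).
  rewrite defM linear_sum -sumrB big_ord5 /= !linearZ /= -!/(B _).
  rewrite tB1 tB2 tB3 tB4 B0 trmx1 -!scalerDr subrr scaler0 add0r.
  rewrite -[B 4 - B 1]opprB -[B 3 - B 2]opprB !scalerN -/S1 -/S2 !scalerBl -!addrA.
  by congr (_ + _); rewrite addrA addrC.
have F0S M : in_bose_mesner R M -> M^T = - M -> F 0 *m M *m F 0 = 0.
  by move=> _; rewrite F0E; apply: const_mx_skew0.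
have S1A : in_bose_mesner R S1.
  by rewrite /S1 -scaleN1r; apply: bm_add; [|apply: bm_scale]; apply: bm_adjmx.
have S2A : in_bose_mesner R S2.
  by rewrite /S2 -scaleN1r; apply: bm_add; [|apply: bm_scale]; apply: bm_adjmx.
have S12_orth : \tr (S1 *m S2) = 0.
  by apply/eqP; rewrite -oppr_eq0 -linearN /= -mulmxN -tS2 trS12.
have addA := @bm_add C X 4 R; have scaleA := @bm_scale C X 4 R.
have mulA := @bm_mul C X 4 R hR; have trA := @bm_tr C X 4 R hR.
have [D1 [D2 [a1 [a2 [b1 [b2 [u1 u2 defS1 defS2 signs]]]]]]] :=
  skew_decomposition addA scaleA mulA trA symA skewA FA Fsym rF Forth Fsum F_neq0
    S1A S2A tS1 tS2 rS1 rS2 S1_neq0 S2_neq0 S12_orth F0S.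
have [rb1 rb2 a1_ge0 a2_ge0 [b1_ge0 b2_ge0]] := signs.
have ra1 := ger0_real a1_ge0; have ra2 := ger0_real a2_ge0.
have trD := @mxtrace_block_units_mul_tr C _ _ F addA mulA trA symA FA Fsym Forth Fsum 1 2 D1 D2.
(* Computing the norms and the inner product of [S1] and [S2] in two ways yields the relations
   required by [eigenvalue_cases]. *)
have := trD a1 a2 a1 a2 isT u1 u2; rewrite -defS1 trS1 !trF hm1 hm2 => /esym rel1.
have := trD b1 b2 b1 b2 isT u1 u2; rewrite -defS2 trS2 !trF hm1 hm2 => /esym rel2.
have := trD a1 a2 b1 b2 isT u1 u2; rewrite -defS1 -defS2 trS12 !trF hm1 hm2 => /esym rel12.
split=> //; pose rho := (r + 'i * a1) / 2; pose tau := (t + 'i * b1) / 2.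
pose sigma := (s + 'i * a2) / 2; pose omega := (u + 'i * b2) / 2.
have AD1 : in_bose_mesner R D1 by case: u1.
have AD2 : in_bose_mesner R D2 by case: u2.
have eigP : is_eigenmatrix R (skew_idempotent F D1 D2)
    (skew_eigenmatrix k1 k2 rho tau sigma omega).
  have conjs := (conj_rect_half rr ra1, conj_rect_half rt rb1,
                 conj_rect_half rs ra2, conj_rect_half ru rb2).
  (* A generic column: the [x] come from the symmetric part of twice an adjacency matrix, the [y]
     from its skew part. *)
  have col c0 x1 y1 x2 y2 : 2^-1 *: (c0 *: F 0 + x1 *: F 1 + x2 *: F 2
      + (y1 *: D1 + y2 *: D2)) = \sum_(k < 5)
      [:: c0 / 2; (x1 + 'i * y1) / 2; (x2 + 'i * y2) / 2; (x2 - 'i * y2) / 2;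
          (x1 - 'i * y1) / 2]`_k *: skew_idempotent F D1 D2 k.
    have -> : 2^-1 *: (c0 *: F 0 + x1 *: F 1 + x2 *: F 2 + (y1 *: D1 + y2 *: D2)) =
       (c0 / 2) *: F 0 + ((x1 / 2) *: F 1 + (y1 / 2) *: D1)
         + ((x2 / 2) *: F 2 + (y2 / 2) *: D2).
      rewrite addrACA !scalerDr !scalerA ![2^-1 * _]mulrC -!addrA.
      by congr (_ + (_ + _)).
    rewrite skew_idempotent_sum; apply: eq_bigr => k _; congr (_ *: _).
    by rewrite !mulrDl !mulNr !mulrA.
  have half (M N : 'M[C]_#|X|) : M = 2^-1 *: (M + N + (M - N)).
    rewrite addrACA subrr addr0 -mulr2n -scaler_nat scalerA mulVf ?scale1r //.
    by rewrite pnatr_eq0.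
  move=> j; rewrite -/(B j).
  have : j \in [:: 0; 1; 2; 3; 4].
    by case: j => [[|[|[|[|[|//]]]]] ltj].
  rewrite !inE => /or4P[| | |/orP[]] /eqP ->.
  - have -> : B 0 = 2^-1 *: (2 *: F 0 + 2 *: F 1 + 2 *: F 2 + (0 *: D1 + 0 *: D2)).
      by rewrite !scale0r !addr0 -!scalerDr scalerA mulVf ?pnatr_eq0 // scale1r eqI.
    rewrite col; have two : 2 / 2 = 1 :> C by rewrite divff ?pnatr_eq0.
    by apply: eq_bigr => -[[|[|[|[|[|//]]]]] ltk] _; rewrite !mxE /= ?mulr0 ?subr0 ?addr0 two.
  - rewrite (half (B 1) (B 4)) eq1 -/S1 defS1 col.
    by apply: eq_bigr => -[[|[|[|[|[|//]]]]] ltk] _; rewrite !mxE /= ?conjs.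
  - rewrite (half (B 2) (B 3)) eq2 -/S2 defS2 col.
    by apply: eq_bigr => -[[|[|[|[|[|//]]]]] ltk] _; rewrite !mxE /= ?conjs.
  (* For the transposed relations the skew part changes sign, which conjugates the eigenvalues. *)
  - rewrite (half (B 3) (B 2)) [B 3 + _]addrC -opprB eq2 -/S2 defS2 opprD -!scaleNr col.
    by apply: eq_bigr => -[[|[|[|[|[|//]]]]] ltk] _; rewrite !mxE /= ?conjs ?mulrN ?opprK.
  - rewrite (half (B 4) (B 1)) [B 4 + _]addrC -opprB eq1 -/S1 defS1 opprD -!scaleNr col.
    by apply: eq_bigr => -[[|[|[|[|[|//]]]]] ltk] _; rewrite !mxE /= ?conjs ?mulrN ?opprK.
exists (skew_idempotent F D1 D2), rho, tau, sigma, omega; split=> //.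
  apply: (idempotent_ordering_basis eigP).
  - exact: skew_idempotentA.
  - exact: (skew_idempotent_orth addA scaleA mulA trA symA FA Fsym Forth Fsum u1 u2).
  - exact: (skew_idempotent_neq0 Fsym F_neq0 u1 u2).
  - by rewrite /skew_idempotent (tnth_nth 0).
have := m_gt0 1; have := m_gt0 2; rewrite hm1 hm2 => m2_gt0 m1_gt0.
exact: eigenvalue_cases.
Qed.
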